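(* Let $R$ be a finite set of positive integers. If $\mathcal F$ is a family (finite or infinite) of $R$-graphs, then $\pi^R(\mathcal F)$ is not a strong jump for $R$.
   Context: A hypergraph is a pair $H=(V,E)$ with $E\subseteq 2^V$; $H$ is an $R$-graph if $|e|\in R$ for every $e\in E$. For an $R$-graph $H$ on $n$ vertices, $h_n(H)=\sum_{e\in E(H)} 1/\binom{n}{|e|}$. For a family $\mathcal F$ of $R$-graphs, $\pi_n(\mathcal F)$ is the maximum of $h_n(G)$ over $\mathcal F$-free $R$-graphs $G$ on $n$ vertices (no member of $\mathcal F$ is a subgraph of $G$), and $\pi^R(\mathcal F)=\lim_{n\to\infty}\pi_n(\mathcal F)$. A value $\alpha\in[0,|R|]$ is a strong jump for $R$ if there exists $c>0$ such that for every integer $t\ge\max R$ there is $n_0$ such that whenever $n\ge n_0$ and $G_n$ is an $R$-graph on $n$ vertices with $h_n(G_n)\ge\alpha-c$, $G_n$ contains a subgraph $H_t$ on $t$ vertices with $h_t(H_t)\ge\alpha+c$. *)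

(* Defs.v *)
From HB Require Import structures.
From mathcomp Require Import all_boot all_order all_algebra finmap.
From mathcomp Require Import all_classical all_reals all_analysis.

Set Implicit Arguments.
Unset Strict Implicit.
Unset Printing Implicit Defensive.

Import Order.TTheory GRing.Theory Num.Theory.
Import numFieldNormedType.Exports.

Local Open Scope classical_set_scope.
Local Open Scope ring_scope.

Record hypergraph := Hypergraph {
  vertices : finType;
  edges : {set {set vertices}} }.

Definition is_Rgraph (R : {fset nat}) (H : hypergraph) : Prop :=
  forall e : {set vertices H}, e \in edges H -> #|e| \in R.

(* Not necessarily induced, and up to relabelling of the vertices. *)
Definition subgraph (H G : hypergraph) : Prop :=
  exists f : vertices H -> vertices G,
    injective f /\
    forall e : {set vertices H}, e \in edges H -> (f @: e)%SET \in edges G.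

(* h_n(H), where n is the number of vertices of H. *)
Definition h (K : realType) (H : hypergraph) : K :=
  \sum_(e in edges H) ('C(#|vertices H|, #|e|)%:R)^-1.

Definition is_free (F : hypergraph -> Prop) (G : hypergraph) : Prop :=
  forall H, F H -> ~ subgraph H G.

(* The maximum ranges over all edge sets on the vertex set 'I_n. Since h is
   nonnegative, the base value 0 matters only if there is no F-free R-graph on
   n vertices, which requires F to contain an edgeless graph. *)
Definition pi_n (K : realType) (R : {fset nat}) (F : hypergraph -> Prop)
    (n : nat) : K :=
  \big[Num.max/0]_(E : {set {set 'I_n}} |
      `[< is_Rgraph R (Hypergraph E) /\ is_free F (Hypergraph E) >])
    h K (Hypergraph E).

Definition turan_density (K : realType) (R : {fset nat})
    (F : hypergraph -> Prop) : K :=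
  limn (pi_n K R F).

Definition strong_jump (K : realType) (R : {fset nat}) (alpha : K) : Prop :=
  0 <= alpha <= (#|` R|)%:R /\
  exists c : K, 0 < c /\
    forall t : nat, (\max_(r <- R) r <= t)%N ->
      exists n0 : nat, forall (n : nat) (G : hypergraph),
        (n0 <= n)%N -> #|vertices G| = n -> is_Rgraph R G ->
        alpha - c <= h K G ->
        exists H : hypergraph,
          [/\ subgraph H G, #|vertices H| = t & alpha + c <= h K H].

(* Main.v *)
Require Import Defs.
From HB Require Import structures.
From mathcomp Require Import all_boot all_order all_algebra finmap.
From mathcomp Require Import all_classical all_reals all_analysis.
(* MathComp-Analysis shadows the finite-set lemma names. *)
From mathcomp Require Import fintype finset.

(* Averaging over vertex deletions shows that pi_n is nonincreasing once
   n >= max R, so it converges to pi from above. If pi were a strong jump with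
   constant c, pick t with pi_t < pi + c. A large F-free graph of density at
   least pi - c would contain a t-vertex graph of density at least pi + c,
   which is again F-free, contradicting pi_t < pi + c. When pi - c < 0, such a
   graph need not exist, but an edgeless graph already refutes the jump. *)

Set Implicit Arguments.
Unset Strict Implicit.
Unset Printing Implicit Defensive.

Import Order.TTheory GRing.Theory Num.Theory.
Import numFieldNormedType.Exports.

Local Open Scope ring_scope.

Lemma subgraph_trans (G H I : hypergraph) :
  subgraph I H -> subgraph H G -> subgraph I G.
Proof.
move=> [f [injf fE]] [g [injg gE]]; exists (g \o f); split.
  exact: inj_comp.
by move=> e /fE/gE; rewrite imset_comp.
Qed.

Lemma subgraph_is_Rgraph (R : {fset nat}) (G H : hypergraph) :
  subgraph H G -> is_Rgraph R G -> is_Rgraph R H.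
Proof. by move=> [f [injf fE]] GR e /fE/GR; rewrite card_imset. Qed.

Lemma subgraph_is_free (F : hypergraph -> Prop) (G H : hypergraph) :
  subgraph H G -> is_free F G -> is_free F H.
Proof. by move=> HG GF I /GF + IH; apply; exact: subgraph_trans HG. Qed.

(** For injective [f], this is the subgraph induced on the image of [f], relabelled by [U]. It
    covers both renumbering by ordinals and deletion of a vertex. *)
Definition preim_graph (G : hypergraph) (U : finType) (f : U -> vertices G) :=
  @Hypergraph U [set e : {set U} | f @: e \in edges G].

Lemma subgraph_preim (G : hypergraph) (U : finType) (f : U -> vertices G) :
  injective f -> subgraph (preim_graph f) G.
Proof. by move=> injf; exists f; split=> // e; rewrite inE. Qed.

Section Density.
Variable K : realType.

(** Direct image under [f] is a cardinality-preserving bijection from the subsets of [U] onto the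
    subsets of the image of [f]. *)
Lemma h_preim (G : hypergraph) (U : finType) (f : U -> vertices G) :
  injective f ->
  h K (preim_graph f) =
  \sum_(e in edges G | e \subset f @: setT) ('C(#|U|, #|e|)%:R)^-1.
Proof.
move=> injf; rewrite [RHS](reindex_onto (fun e : {set U} => f @: e)
  (fun e : {set vertices G} => f @^-1: e)) /=.
  apply: eq_big => [e|e _]; last by rewrite card_imset.
  have -> : f @: e \subset f @: setT by rewrite imsetS // subsetT.
  suff -> : f @^-1: (f @: e) == e by rewrite inE !andbT.
  by apply/eqP/setP => x; rewrite inE mem_imset.
move=> e /andP[_ /subsetP eE]; apply/setP => y; apply/imsetP/idP.
  by move=> [x + ->]; rewrite inE.
by move=> ye; have /imsetP[x _ yE] := eE _ ye; exists x => //; rewrite inE -yE.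
Qed.

Lemma h_edgeless (G : hypergraph) : edges G = set0 -> h K G = 0.
Proof. by rewrite /h => ->; rewrite big_set0. Qed.

Lemma subgraph_edgeless (G H : hypergraph) :
  subgraph H G -> edges G = set0 -> edges H = set0.
Proof.
move=> [f [_ fE]] G0; apply/eqP; rewrite -subset0; apply/subsetP => e /fE.
by rewrite G0 inE.
Qed.

Section Turan.
Variables (R : {fset nat}) (F : hypergraph -> Prop).

Lemma pi_n_ge0 n : 0 <= pi_n K R F n.
Proof. by apply/bigmax_geP; left. Qed.

(** The maximum in [pi_n] sees only graphs on ordinals; enumerating the vertices of [G] extends the
    bound to any vertex type. *)
Lemma h_le_pi_n (G : hypergraph) :
  is_Rgraph R G -> is_free F G -> h K G <= pi_n K R F #|vertices G|.
Proof.
move=> GR GF; set f : 'I_#|vertices G| -> vertices G := enum_val.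
have injf : injective f by exact: enum_val_inj.
have sub := subgraph_preim injf.
have <- : h K (preim_graph f) = h K G.
  rewrite h_preim // card_ord; apply: eq_bigl => e.
  suff -> : f @: setT = setT by rewrite subsetT andbT.
  by apply/setP => x; rewrite inE -(enum_rankK x) imset_f.
apply: (le_bigmax_cond 0
  (fun E : {set {set 'I_#|vertices G|}} => h K (Hypergraph E))).
apply/asboolP; split.
  exact: subgraph_is_Rgraph sub GR.
exact: subgraph_is_free sub GF.
Qed.

Lemma leq_Rgraph_edge (G : hypergraph) (e : {set vertices G}) :
  is_Rgraph R G -> e \in edges G -> (#|e| <= \max_(r <- R) r)%N.
Proof. by move=> GR /GR eR; apply: (leq_bigmax_seq (F := id)). Qed.

(** Double counting: an edge [e] survives exactly the deletions of the [n.+1 - #|e|] vertices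
    outside it. The bound on [R] excludes edges of size [n.+1], which would survive none. *)
Lemma sum_h_vertex_deletion n (E : {set {set 'I_n.+1}}) :
  is_Rgraph R (Hypergraph E) -> (\max_(r <- R) r <= n)%N ->
  \sum_(i < n.+1) h K (@preim_graph (Hypergraph E) 'I_n (lift i)) =
  n.+1%:R * h K (Hypergraph E).
Proof.
move=> ER maxR.
have liftT (i : 'I_n.+1) : lift i @: setT = [set~ i].
  apply/setP => j; rewrite !inE; apply/imsetP/idP => [[k _ ->]|].
    by rewrite eq_sym neq_lift.
  by rewrite eq_sym => /unlift_some[k -> _]; exists k.
under eq_bigr => i _ do
  rewrite (@h_preim (Hypergraph E) _ _ (@lift_inj _ i)) liftT card_ord.
rewrite /h mulr_sumr card_ord (exchange_big_dep (mem E)) /=; last first.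
  by move=> i e _ /andP[].
apply: eq_bigr => e eE.
have en : (#|e| <= n)%N := leq_trans (leq_Rgraph_edge ER eE) maxR.
rewrite (eq_bigl (mem (~: e))) => [|i]; last first.
  by rewrite eE /= inE subsetC sub1set inE.
rewrite sumr_const -[LHS]mulr_natl cardsCs setCK card_ord.
(* Cross-multiplied, with [k = #|e|], the claim is [(n.+1 - k) * 'C(n.+1, k) = n.+1 * 'C(n, k)]. *)
apply/eqP; rewrite eqr_div ?pnatr_eq0 -?lt0n ?bin_gt0 //; last exact: leqW.
by rewrite -!natrM -mul_bin_down.
Qed.

(** The density of a free graph is the average of those of its vertex-deleted subgraphs, which are
    again free. *)
Lemma pi_nS n : (\max_(r <- R) r <= n)%N -> pi_n K R F n.+1 <= pi_n K R F n.
Proof.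
move=> maxR; apply/bigmax_leP; split; first exact: pi_n_ge0.
move=> E /asboolP[ER EF].
rewrite -(ler_pM2l (ltr0Sn K n)) -sum_h_vertex_deletion //.
rewrite mulr_natl -[X in _ *+ X]card_ord -sumr_const; apply: ler_sum => i _.
have sub := @subgraph_preim (Hypergraph E) _ _ (@lift_inj n.+1 i).
rewrite -[X in pi_n _ _ _ X]card_ord.
apply: (@h_le_pi_n (@preim_graph (Hypergraph E) 'I_n (lift i))).
  exact: subgraph_is_Rgraph sub ER.
exact: subgraph_is_free sub EF.
Qed.

Let N := (\max_(r <- R) r)%N.
(** The shift by [N] starts the sequence where monotonicity is guaranteed. *)
Let u := fun n => pi_n K R F (n + N).

Let u_noninc : {homo u : m n / (m <= n)%N >-> n <= m}.
Proof.
by apply/nonincreasing_seqP => n; rewrite /u addSn pi_nS // leq_addl.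
Qed.

Let u_cvg : (u @ \oo --> turan_density K R F)%classic.
Proof.
have cu : cvgn u.
  apply: nonincreasing_is_cvgn => //.
  by exists 0 => _ [n _ <-]; exact: pi_n_ge0.
(* Convergence of [u] passes to the unshifted sequence, so the [limn] in [turan_density] is a
   genuine limit. *)
rewrite /turan_density; suff <- : limn u = limn (pi_n K R F) by [].
apply/esym/cvg_lim => //; move: cu.
by rewrite (cvg_shiftn N (pi_n K R F)).
Qed.

Lemma turan_density_le_pi_n n :
  (N <= n)%N -> turan_density K R F <= pi_n K R F n.
Proof.
move=> Nn; have := nonincreasing_cvgn_ge u_noninc (cvgP _ u_cvg) (n - N).
by rewrite (cvg_lim _ u_cvg) // /u subnK.
Qed.

Lemma pi_n_lt_turan_densityD (c : K) :
  0 < c -> exists2 t, (N <= t)%N & pi_n K R F t < turan_density K R F + c.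
Proof.
move=> c0; have /(cvgr_lt _ u_cvg) : turan_density K R F < turan_density K R F + c.
  by rewrite ltrDl.
by move=> [m _ /(_ m (leqnn m))]; exists (m + N)%N => //; exact: leq_addl.
Qed.

End Turan.
End Density.

Theorem theorem5 (K : realType) (R : {fset nat})
    (R_pos : forall r : nat, r \in R -> (0 < r)%N)
    (F : hypergraph -> Prop)
    (F_Rgraphs : forall H : hypergraph, F H -> is_Rgraph R H) :
  ~ strong_jump R (turan_density K R F).
Proof.
move=> [/andP[pi0 _] [c [c0 jump]]].
have [t maxRt pit] := pi_n_lt_turan_densityD R F c0.
have [n0 {}jump] := jump t maxRt.
(* Large enough both for the jump and for [pi_n] to lie above its limit. *)
pose n := maxn n0 (\max_(r <- R) r).
have : turan_density K R F - c < pi_n K R F n.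
  rewrite (@lt_le_trans _ _ (turan_density K R F)) ?ltrBlDr ?ltrDl //.
  by apply: turan_density_le_pi_n; exact: leq_maxr.
(* Either the default value [0] of the maximum already exceeds the bound, or some free graph [E]
   does. *)
move=> /bigmax_gtP[neg|[E /asboolP[ER EF] Eh]].
  pose G := @Hypergraph 'I_n set0.
  have [||||H [HG _]] := jump n G.
  - exact: leq_maxl.
  - exact: card_ord.
  - by move=> e; rewrite inE.
  - by rewrite h_edgeless // ltW.
  rewrite (h_edgeless K (subgraph_edgeless HG erefl)).
  by rewrite leNgt ltr_wpDl.
have [||||H [HG Ht]] := jump n (Hypergraph E) => //.
- exact: leq_maxl.
- exact: card_ord.
- exact: ltW.
rewrite leNgt (le_lt_trans _ pit) // -Ht; apply: h_le_pi_n.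
  exact: subgraph_is_Rgraph HG ER.
exact: subgraph_is_free HG EF.
Qed.
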